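(* Let $S(e_1,\dots,e_k)$ be a rational normal scroll and let $P=\sum_{|I|=2}\sum_k p_{I,k}\,s^{\langle e,I\rangle-b-k}t^kz^I$ define a divisor of type $2H-bR$ on it. It leads to quadratic base equations $\pi_1,\dots,\pi_{b-1}$ (for a suitable choice, see the context). The coefficient $p_{I,k}$ gives the following term (to be multiplied by $p_{I,k}$) in $\pi_m$. Write $z^I=xy$ with $e_x\ge e_y$ (where $x=y$ is allowed), and denote the scrollar deformation variables belonging to $x$ and $y$ by $\xi_j$ and $\eta_j$. I. If $e_x<b$, then for $m\le k$ the term is $-\sum_{l=m}^{k}\eta_{k-l+m}\xi_l$, while for $m>k$ it is $$\sum_{l=\max(k+m-e_y+1,\,k+1)}^{\min(e_x-1,\,m-1)}\eta_{k-l+m}\xi_l .$$ II. If $e_x\ge b$, then for $m\le k+b-e_x$ the term is $-\sum_{l=m+e_x-b}^{k}\eta_{k-l+m}\xi_l$, while for $m>k+b-e_x$ it is $$\sum_{l=\max(k+m-e_y+1,\,k+1)}^{\min(e_x-b+m-1,\,k+m-1)}\eta_{k-l+m}\xi_l .$$ Furthermore, if $e_x\ge b$, the $e_x-b+1$ pure rolling factors deformations involving $x$, with parameters $\rho_0,\dots,\rho_{e_x-b}$, contribute $\rho_0\xi_m+\dots+\rho_{e_x-b}\xi_{m+e_x-b}$ to $\pi_m$.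
   Context: Work over $\mathbb{C}$. The scroll $S(e_1,\dots,e_k)$ has bihomogeneous coordinates $(z^{(1)}:\dots:z^{(k)};s:t)$, with $z^{(i)}$ of weight $-e_i$; the coordinates on projective space are $z^{(i)}_j=z^{(i)}s^{e_i-j}t^j$, $0\le j\le e_i$; the scroll is given by the $2\times 2$ minors of the matrix with columns $(z^{(i)}_j,z^{(i)}_{j+1})$, $0\le j\le e_i-1$. $H$ is the hyperplane class and $R$ the ruling. Notation: $e=(e_1,\dots,e_k)$, $|I|=\sum i_l$, $\langle e,I\rangle=\sum e_li_l$, $z^I=\prod(z^{(l)})^{i_l}$. If $x=z^{(i)}$, then $e_x=e_i$. (In the double sum for $P$ the summation index $k$ runs over $0\le k\le\langle e,I\rangle-b$ and is unrelated to the dimension of the scroll.) Rolling factors: write $\alpha$ for a pair $(i,j)$, $0\le j\le e_i-1$, $z_\alpha=z^{(i)}_j$, $z_{\alpha+1}=z^{(i)}_{j+1}$. The polynomial $P_m$ ($0\le m\le b$) is a quadratic form in the $z^{(i)}_j$ representing $s^{b-m}t^mP$, chosen such that $P_m=\sum_\alpha p_{\alpha,m}z_\alpha$, $P_{m+1}=\sum_\alpha p_{\alpha,m}z_{\alpha+1}$ for $0\le m<b$. Deformation variables: scrollar deformations $\zeta^{(i)}_j$, $1\le j\le e_i-1$, perturb the matrix to the one with columns $(z_\alpha,z_{\alpha+1}+\zeta_{\alpha+1})$; variables with index outside the range $1\le j\le e_i-1$ are $0$. For each $i$ with $e_i\ge b$ there are pure rolling factors deformations $\rho_0,\dots,\rho_{e_i-b}$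 perturbing $P_m$ by $\rho_0z^{(i)}_m+\dots+\rho_{e_i-b}z^{(i)}_{m+e_i-b}$. Suppose that the lifting conditions are satisfied, i.e. there are $P'_m(z,\zeta,\rho)$, linear in $z$ and containing, for each $i$ with $e_i\ge b$, the pure rolling factors perturbation $\rho_0z^{(i)}_m+\dots+\rho_{e_i-b}z^{(i)}_{m+e_i-b}$, such that on the scroll $sP'_{m+1}-tP'_m-s\sum_\alpha p_{\alpha,m}\zeta_{\alpha+1}=0$ for $0\le m<b$; these conditions are linear equations in the $\zeta^{(i)}_j$ (the lifting equations). Then the infinitesimal deformation $P_m+P_m'$ extends maximally over the base defined (besides the lifting equations) by the $b-1$ base equations $$\pi_m:=P_m'(\zeta,\zeta,\rho)-P_m(\zeta)=0,\qquad 1\le m\le b-1,$$ where the variables $z^{(i)}_j$ are replaced by $\zeta^{(i)}_j$. The base equations are not unique: they depend on the choice of the $P_m$ and $P_m'$, and are determined up to multiples of the linear lifting equations and coordinate changes using the $\rho$-variables; the theorem describes them for a suitable choice. In Cases I and II, if $x=y$ then $\eta_j=\xi_j$. Sums with upper limit smaller than lower limit are zero. *)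

(* Defs.v *)
From HB Require Import structures.
From mathcomp Require Export all_boot all_order all_algebra.
From mathcomp Require Export reals complex mpoly.

Set Implicit Arguments.
Unset Strict Implicit.
Unset Printing Implicit Defensive.

Import GRing.Theory.
Local Open Scope ring_scope.

(* Conventions: the scroll is S(e_0, ..., e_{n-1}) with e : 'I_n -> nat (e_i = 0
   is allowed), and the divisor has type 2H - bR.  Definitions take a ground
   ring K and, where a test algebra is needed, a commutative K-algebra A. *)

(* The index (i, j), 0 <= j <= e_i, of the coordinate z^(i)_j. *)
Definition zvar (n : nat) (e : 'I_n -> nat) : finType :=
  {i : 'I_n & 'I_(e i).+1}.

(* The index alpha = (i, j), 0 <= j < e_i, of a column (z_alpha, z_{alpha+1}). *)
Definition zcol (n : nat) (e : 'I_n -> nat) : finType := {i : 'I_n & 'I_(e i)}.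

Definition zring (A : nzRingType) (n : nat) (e : 'I_n -> nat) :=
  {mpoly A[#|zvar e|]}.

(* z^(i)_j; only meaningful (and only used) for j <= e_i. *)
Definition zcoord (A : nzRingType) (n : nat) (e : 'I_n -> nat)
    (i : 'I_n) (j : nat) : zring A e :=
  'X_(enum_rank (existT (fun i => 'I_(e i).+1) i (inord j) : zvar e)).

(* The bihomogeneous coordinate ring A[z^(1), ..., z^(n), s, t] of the scroll. *)
Definition coxring (A : nzRingType) (n : nat) := {mpoly A[n + 2]}.

Definition cox_z (A : nzRingType) (n : nat) (i : 'I_n) : coxring A n :=
  'X_(lshift 2 i).
Definition cox_s (A : nzRingType) (n : nat) : coxring A n :=
  'X_(rshift n (ord0 : 'I_2)).
Definition cox_t (A : nzRingType) (n : nat) : coxring A n :=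
  'X_(rshift n (ord_max : 'I_2)).

(* Restriction to the scroll: z^(i)_j |-> z^(i) s^(e_i - j) t^j. *)
Definition on_scroll (A : comNzRingType) (n : nat) (e : 'I_n -> nat)
    (f : zring A e) : coxring A n :=
  mmap (@mpolyC (n + 2) A)
       (fun v => let c : {i : 'I_n & 'I_(e i).+1} := enum_val v in
          cox_z A (tag c) * cox_s A n ^+ (e (tag c) - tagged c)
            * cox_t A n ^+ tagged c) f.

Definition pairing (n : nat) (e : 'I_n -> nat) (I : 'X_{1..n}) : nat :=
  (\sum_(i < n) e i * I i)%N.

(* Number of k with 0 <= k <= <e,I> - b (zero if <e,I> < b). *)
Definition ncoef (n : nat) (e : 'I_n -> nat) (b : nat) (I : 'X_{1..n}) : nat :=
  ((pairing e I).+1 - b)%N.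

Definition divisor_poly (K : comNzRingType) (n : nat) (e : 'I_n -> nat) (b : nat)
    (p : 'X_{1..n} -> nat -> K) : coxring K n :=
  \sum_(I : 'X_{1..n < 3} | mdeg I == 2) \sum_(k < ncoef e b I)
     p I k *: (cox_s K n ^+ (pairing e I - b - k) * cox_t K n ^+ k
               * \prod_(i < n) cox_z K i ^+ I i).

(* The P_m (0 <= m <= b) with linear coefficients p_{alpha,m} (0 <= m < b). *)
Definition rolling_factors (K : comNzRingType) (n : nat) (e : 'I_n -> nat)
    (b : nat) (P : coxring K n)
    (Pm : nat -> zring K e) (pl : zcol e -> nat -> zring K e) : Prop :=
  [/\ forall m, (m <= b)%N -> Pm m \is 2.-homog,
      forall m, (m <= b)%N ->
        on_scroll (Pm m) = cox_s K n ^+ (b - m) * cox_t K n ^+ m * P,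
      forall a m, (m < b)%N -> pl a m \is 1.-homog
    & forall m, (m < b)%N ->
        Pm m = \sum_(a : zcol e) pl a m * zcoord K e (tag a) (tagged a)
     /\ Pm m.+1 = \sum_(a : zcol e) pl a m * zcoord K e (tag a) (tagged a).+1].

(* (i, j') stands for zeta^(i)_{j'+1}, so that 1 <= j'+1 <= e_i - 1. *)
Definition zetavar (n : nat) (e : 'I_n -> nat) : finType :=
  {i : 'I_n & 'I_(e i).-1}.

(* (i, a) stands for the parameter rho_a of z^(i), 0 <= a <= e_i - b; there is
   no such pair when e_i < b. *)
Definition rhovar (n : nat) (e : 'I_n -> nat) (b : nat) : finType :=
  {i : 'I_n & 'I_((e i).+1 - b)}.

Definition defvar (n : nat) (e : 'I_n -> nat) (b : nat) : finType :=
  (zetavar e + rhovar e b)%type.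

Definition defring (K : comNzRingType) (n : nat) (e : 'I_n -> nat) (b : nat) :=
  {mpoly K[#|defvar e b|]}.

(* zeta^(i)_j, equal to 0 unless 1 <= j <= e_i - 1. *)
Definition zeta (K : comNzRingType) (n : nat) (e : 'I_n -> nat) (b : nat)
    (i : 'I_n) (j : nat) : defring K e b :=
  if (0 < j)%N then
    oapp (fun j' : 'I_(e i).-1 =>
            'X_(enum_rank (inl (existT _ i j' : zetavar e) : defvar e b)))
         0 (insub j.-1)
  else 0.

(* rho^(i)_a, equal to 0 unless a <= e_i - b. *)
Definition rho (K : comNzRingType) (n : nat) (e : 'I_n -> nat) (b : nat)
    (i : 'I_n) (a : nat) : defring K e b :=
  oapp (fun a' : 'I_((e i).+1 - b) =>
          'X_(enum_rank (inr (existT _ i a' : rhovar e b) : defvar e b)))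
       0 (insub a).

Definition at_point (K : comNzRingType) (A : comAlgType K)
    (n : nat) (e : 'I_n -> nat) (b : nat) (v : defvar e b -> A)
    (f : defring K e b) : A :=
  mmap (in_alg A) (fun w => v (enum_val w)) f.

(* The identity s P'_{m+1} - t P'_m - s sum_alpha p_{alpha,m} zeta_{alpha+1} = 0
   on the scroll, for 0 <= m < b, at the A-valued point v. *)
Definition lifting_identity (K : comNzRingType) (A : comAlgType K)
    (n : nat) (e : 'I_n -> nat) (b : nat) (pl : zcol e -> nat -> zring K e)
    (v : defvar e b -> A) (Q : nat -> zring A e) : Prop :=
  forall m, (m < b)%N ->
    cox_s A n * on_scroll (Q m.+1) - cox_t A n * on_scroll (Q m)
    - cox_s A n * \sum_(a : zcol e)
        at_point v (zeta K e b (tag a) (tagged a).+1)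
          *: on_scroll (map_mpoly (in_alg A) (pl a m))
    = 0.

(* v satisfies the lifting equations: the identity is solvable in linear forms. *)
Definition lifting_conditions (K : comNzRingType) (A : comAlgType K)
    (n : nat) (e : 'I_n -> nat) (b : nat) (pl : zcol e -> nat -> zring K e)
    (v : defvar e b -> A) : Prop :=
  exists Q : nat -> zring A e,
    (forall m, (m <= b)%N -> Q m \is 1.-homog) /\ lifting_identity pl v Q.

Definition pure_rolling (K : comNzRingType) (n : nat) (e : 'I_n -> nat)
    (b : nat) (m : nat) : zring (defring K e b) e :=
  \sum_(i < n) \sum_(a < (e i).+1 - b)
     rho K e b i a *: zcoord (defring K e b) e i (m + a).

(* P'_m is bilinear in (z, zeta), plus the pure rolling factors perturbations. *)
Definition perturbation_form (K : comNzRingType) (n : nat) (e : 'I_n -> nat)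
    (b : nat) (P' : nat -> zring (defring K e b) e) : Prop :=
  exists q : nat -> zvar e -> zetavar e -> K,
    forall m, (m <= b)%N ->
      P' m = \sum_(c : zvar e) \sum_(d : zetavar e)
               (q m c d *: zeta K e b (tag d) (tagged d).+1)
                 *: zcoord (defring K e b) e (tag c) (tagged c)
             + pure_rolling K e b m.

(* P'_m(z, zeta, rho) solves the lifting problem over the whole locus cut out by
   the lifting equations, A-valued points included. *)
Definition lifting_family (K : comNzRingType) (n : nat) (e : 'I_n -> nat)
    (b : nat) (pl : zcol e -> nat -> zring K e)
    (P' : nat -> zring (defring K e b) e) : Prop :=
  perturbation_form P' /\
  forall (A : comAlgType K) (v : defvar e b -> A),
    lifting_conditions pl v ->
    lifting_identity pl v (fun m => map_mpoly (at_point v) (P' m)).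

(* z^(i)_j |-> zeta^(i)_j; this kills z^(i)_0 and z^(i)_{e_i}. *)
Definition zeta_point (K : comNzRingType) (n : nat) (e : 'I_n -> nat) (b : nat)
    (w : 'I_#|zvar e|) : defring K e b :=
  let c : {i : 'I_n & 'I_(e i).+1} := enum_val w in
   zeta K e b (tag c) (tagged c).

Definition base_equation (K : comNzRingType) (n : nat) (e : 'I_n -> nat)
    (b : nat) (Pm : nat -> zring K e) (P' : nat -> zring (defring K e b) e)
    (m : nat) : defring K e b :=
  (P' m).@[@zeta_point K n e b]
  - mmap (@mpolyC #|defvar e b| K) (@zeta_point K n e b) (Pm m).

(* The term belonging to s^(ex+ey-b-k) t^k x y in pi_m, with ey <= ex.  All
   subtractions are arranged so that truncation does not change the value:
   eta_{k-l+m} is written eta (k + m - l), where l <= k + m throughout, and the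
   lower bound k+m-ey+1 is only used under a maximum with k+1. *)
Definition base_term (A : nzRingType) (ex ey b k m : nat) (xi eta : nat -> A) : A :=
  if (ex < b)%N then
    if (m <= k)%N then
      - \sum_(m <= l < k.+1) eta (k + m - l)%N * xi l
    else
      \sum_(maxn (k + m + 1 - ey) k.+1 <= l < (minn ex.-1 m.-1).+1)
         eta (k + m - l)%N * xi l
  else
    if (m + ex <= k + b)%N then
      - \sum_(m + ex - b <= l < k.+1) eta (k + m - l)%N * xi l
    else
      \sum_(maxn (k + m + 1 - ey) k.+1 <= l
              < (minn (ex - b + m - 1) (k + m - 1)).+1)
         eta (k + m - l)%N * xi l.

(* Main.v *)
(* Proof idea.  The term s^(ex+ey-b-k) t^k xy is rolled along the path x_i y_j,
   i + j = k + m, that first raises i, starting from min(k, max(ex - b, 0)), and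
   raises j only once i has reached ex.  A step from m = l to m = l + 1 that keeps
   the coordinate z_g, and moves one whose deformation variable is d, asks for
   linear forms Q_m with s Q_{m+1} - t Q_m = [m = l] s d z_g on the scroll.  One
   takes Q_m = d z_{g+m-l-1} for m > l and 0 otherwise if g <= l, and
   Q_m = - d z_{g+m-l-1} for m <= l and 0 otherwise if g > l.  In the first case
   the index may run past the end of its rational normal curve; truncating there
   leaves terms - t d z_e, and the sum of those landing on the same curve at the
   same m is a lifting equation.  After the substitution z = zeta the steps raising
   j contribute nothing, since xi_ex = 0, and what the steps raising i contribute
   combines with - xi_i eta_j to the stated sum. *)
From HB Require Import structures.
Require Import Defs.
From mathcomp Require Import zify ring.

Set Implicit Arguments.
Unset Strict Implicit.
Unset Printing Implicit Defensive.

Import GRing.Theory.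
Local Open Scope ring_scope.

(** * Restriction to the scroll, coordinates and substitutions *)

HB.instance Definition _ (A : comNzRingType) (n : nat) (e : 'I_n -> nat) :=
  GRing.RMorphism.copy (@on_scroll A n e) (@on_scroll A n e).
HB.instance Definition _ (K : comNzRingType) (A : comAlgType K) (n : nat)
    (e : 'I_n -> nat) (b : nat) (v : defvar e b -> A) :=
  GRing.RMorphism.copy (at_point v) (at_point v).

(** A part [g] with [s * g' = t * g] drops out of the lifting identity; this removes the pure
    rolling factors. *)
Lemma mulrBB_eq0 (B : pzRingType) (s t p' p q x' x g' g y : B) :
  p' = x' + g' -> p = x + g -> q = y -> s * g' = t * g ->
  s * x' - t * x - s * y = 0 -> s * p' - t * p - s * q = 0.
Proof. by move=> -> -> -> h <-; rewrite !mulrDr h opprD addrACA subrr addr0. Qed.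

Lemma on_scrollZ (A : comNzRingType) n (e : 'I_n -> nat) a (f : zring A e) :
  on_scroll (a *: f) = a *: on_scroll f.
Proof. by rewrite /on_scroll mmapZ mul_mpolyC. Qed.

Lemma on_scroll_zcoord (A : comNzRingType) n (e : 'I_n -> nat) i j :
  (j <= e i)%N ->
  on_scroll (zcoord A e i j) = cox_z A i * cox_s A n ^+ (e i - j) * cox_t A n ^+ j.
Proof.
by move=> hj; rewrite /on_scroll /zcoord mmapX mmap1U enum_rankK /= inordK.
Qed.

Lemma rolling_zcoord (A : comNzRingType) n (e : 'I_n -> nat) i j :
  (j < e i)%N ->
  cox_s A n * on_scroll (zcoord A e i j.+1) = cox_t A n * on_scroll (zcoord A e i j).
Proof.
move=> hj; rewrite !on_scroll_zcoord ?(ltnW hj) // -(subnSK hj) !exprS.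
ring.
Qed.

Lemma zcoord_homog (A : nzRingType) n (e : 'I_n -> nat) i j :
  zcoord A e i j \is 1.-homog.
Proof. by rewrite /zcoord dhomogX /= mdeg1. Qed.

Lemma map_zcoord (A B : nzRingType) (f : {rmorphism A -> B}) n (e : 'I_n -> nat) i j :
  map_mpoly f (zcoord A e i j) = zcoord B e i j.
Proof. by rewrite /zcoord map_mpolyX. Qed.

Lemma mmap_zcoord (K : comNzRingType) n (e : 'I_n -> nat) b i j : (j <= e i)%N ->
  mmap (@mpolyC #|defvar e b| K) (@zeta_point K n e b) (zcoord K e i j) = zeta K e b i j.
Proof.
by move=> hj; rewrite /zcoord mmapX mmap1U /zeta_point enum_rankK /= inordK.
Qed.

Lemma meval_zcoord (K : comNzRingType) n (e : 'I_n -> nat) b i j : (j <= e i)%N ->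
  (zcoord (defring K e b) e i j).@[@zeta_point K n e b] = zeta K e b i j.
Proof.
by move=> hj; rewrite /zcoord mevalXU /zeta_point enum_rankK /= inordK.
Qed.

Lemma map_in_algZ (K : comNzRingType) (A : comAlgType K) n c (f : {mpoly K[n]}) :
  map_mpoly (in_alg A) (c *: f) = (c%:A : A) *: map_mpoly (in_alg A) f.
Proof. exact: (map_mpolyZ (in_alg A)). Qed.

Lemma zeta_out (K : comNzRingType) n (e : 'I_n -> nat) b i j :
  ~~ (0 < j < e i)%N -> zeta K e b i j = 0.
Proof. by rewrite /zeta; case: j => //= j h; rewrite insubF //; lia. Qed.

Lemma at_pointZ (K : comNzRingType) (A : comAlgType K) n (e : 'I_n -> nat) b
    (v : defvar e b -> A) c f :
  at_point v (c *: f) = c *: at_point v f.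
Proof. by rewrite /at_point mmapZ /= mulr_algl. Qed.

(** Letting [F] take a natural number avoids transport along [i = v] and serves columns, coordinates
    and deformation variables alike. *)
Lemma big_tagged_pred1 (V : nmodType) n (f : 'I_n -> nat) (v : 'I_n) (a : nat)
    (F : 'I_n -> nat -> V) : (a < f v)%N ->
  \sum_(c : {i : 'I_n & 'I_(f i)} | (tag c == v) && (tagged c == a :> nat))
     F (tag c) (tagged c) = F v a.
Proof.
move=> ha; rewrite (big_pred1 (existT (fun i => 'I_(f i)) v (Ordinal ha))) //.
move=> c; apply/andP/eqP => [|->] //=.
case: c => i j /= [/eqP hi /eqP hj].
by subst i; congr existT; apply: val_inj.
Qed.

(** * Charts of the scroll *)

(* The chart z^(w) = s = 1, t = 'X, z^(i) = 0 for i <> w, in which the lifting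
   identities are recursions between coefficients of polynomials. *)
Definition chart_point (A : comNzRingType) n (w : 'I_n) (j : 'I_(n + 2)) : {poly A} :=
  match split j with
  | inl i => (i == w)%:R
  | inr j' => if j' == 0 then 1 else 'X
  end.

Definition chart (A : comNzRingType) n (w : 'I_n) (f : coxring A n) : {poly A} :=
  mmap (@polyC A) (chart_point A w) f.
HB.instance Definition _ (A : comNzRingType) n (w : 'I_n) :=
  GRing.RMorphism.copy (@chart A n w) (@chart A n w).

Section Chart.
Variables (A : comNzRingType) (n : nat) (w : 'I_n) (e : 'I_n -> nat).

Lemma chartZ a (f : coxring A n) : chart w (a *: f) = a *: chart w f.
Proof. by rewrite /chart mmapZ mul_polyC. Qed.

Lemma chart_z i : chart w (cox_z A i) = (i == w)%:R.
Proof. by rewrite /chart /cox_z mmapX mmap1U /chart_point (unsplitK (inl i)). Qed.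

Lemma chart_s : chart w (cox_s A n) = 1.
Proof. by rewrite /chart /cox_s mmapX mmap1U /chart_point (unsplitK (inr ord0)). Qed.

Lemma chart_t : chart w (cox_t A n) = 'X.
Proof. by rewrite /chart /cox_t mmapX mmap1U /chart_point (unsplitK (inr ord_max)). Qed.

Lemma chart_rolling (f g h : coxring A n) :
  cox_s A n * f - cox_t A n * g - cox_s A n * h = 0 ->
  chart w f = 'X * chart w g + chart w h.
Proof.
move/(congr1 (chart w)); rewrite !rmorphB !rmorphM rmorph0 /= chart_s chart_t !mul1r.
by move/eqP; rewrite subr_eq add0r subr_eq addrC => /eqP.
Qed.

Lemma chart_zcoord i j : (j <= e i)%N ->
  chart w (on_scroll (zcoord A e i j)) = (i == w)%:R *: 'X^j.
Proof.
move=> hj; rewrite on_scroll_zcoord // !rmorphM !rmorphXn /= chart_z chart_s chart_t.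
by rewrite expr1n mulr1 -mul_polyC rmorph_nat.
Qed.

Lemma chart_coef_big (f : zring A e) j : f \is 1.-homog -> (e w < j)%N ->
  (chart w (on_scroll f))`_j = 0.
Proof.
move=> /dhomogP hf hj; rewrite (congr1 (@on_scroll A n e) (mpolyE f)).
rewrite (rmorph_sum (@on_scroll A n e)) (rmorph_sum (@chart A n w)) coef_sum big_seq big1 //= => m hm.
have /eqP/mdeg1P[u /eqP ->] := hf _ hm.
rewrite on_scrollZ chartZ coefZ -[u]enum_valK.
case: (enum_val u) => i g; rewrite -[g]inord_val -/(zcoord A e i g) chart_zcoord -1?ltnS //.
rewrite coefZ coefXn; case: eqVneq => [hi|]; last by rewrite mul0r mulr0.
suff -> : (j == g) = false by rewrite !mulr0.
by have := ltn_ord g; move: hj; rewrite -hi; lia.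
Qed.
End Chart.

(* Without this, unification unfolds these maps into big sums over msupp. *)
Local Opaque on_scroll chart at_point map_mpoly zcoord zeta rho.

(** * Steps and the perturbation they induce *)

(* A step s passes from m = lev s to m + 1 by raising the index mi s of the variable
   mv s, while the other factor of the monomial is coordinate ki s of kv s. *)
Section Scheme.
Variables (K : comNzRingType) (n b : nat) (e : 'I_n -> nat).
Variables (S : finType) (Q : pred S) (c : S -> K) (lev mi ki : S -> nat)
  (mv kv : S -> 'I_n).
Hypothesis mi_lt : forall s, Q s -> (mi s < e (mv s))%N.
Hypothesis ki_le : forall s, Q s -> (ki s <= e (kv s))%N.

Definition step_pl (a : zcol e) (m : nat) : zring K e :=
  \sum_(s | (Q s && (lev s == m)) && ((tag a == mv s) && (tagged a == mi s :> nat)))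
    c s *: zcoord K e (kv s) (ki s).

Lemma step_pl_homog a m : step_pl a m \is 1.-homog.
Proof. by apply: rpred_sum => s _; apply: dhomogZ; apply: zcoord_homog. Qed.

Lemma sum_steps (V : nmodType) (F : S -> 'I_n -> nat -> V) m :
  \sum_(a : zcol e)
    \sum_(s | (Q s && (lev s == m)) && ((tag a == mv s) && (tagged a == mi s :> nat)))
      F s (tag a) (tagged a)
  = \sum_(s | Q s && (lev s == m)) F s (mv s) (mi s).
Proof.
rewrite (exchange_big_dep (fun s => Q s && (lev s == m))) /=; last first.
  by move=> a s _ /andP[].
apply: eq_bigr => s /andP[hs hl].
by rewrite hs hl /= (big_tagged_pred1 (f := e) (F s) (mi_lt hs)).
Qed.

(** Truncated subtraction does no harm: wherever [shift_sign] is nonzero, [lev s < m] or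
    [lev s < ki s]. *)
Definition shift_index (s : S) (m : nat) : nat := (ki s + m - (lev s).+1)%N.

(** In the second branch a nonzero sign means [m <= lev s], so the index is below [ki s]; only the
    first branch has to test for the end of the curve. *)
Definition shift_sign (s : S) (m : nat) : K :=
  if (ki s <= lev s)%N then ((lev s < m) && (shift_index s m <= e (kv s)))%N%:R
  else - (m <= lev s)%N%:R.

Definition step_perturbation (m : nat) : zring (defring K e b) e :=
  \sum_(s | Q s) ((c s * shift_sign s m) *: zeta K e b (mv s) (mi s).+1)
                  *: zcoord (defring K e b) e (kv s) (shift_index s m)
  + pure_rolling K e b m.

Lemma shift_index_le s m : Q s -> (m <= b)%N ->
  (shift_index s m <= e (kv s))%N \/ shift_sign s m = 0.
Proof.
move=> hs hm; have := ki_le hs; rewrite /shift_sign => hk.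
case: (leqP (shift_index s m) (e (kv s))) => h; [by left | right].
rewrite andbF; case: leqP => // h1.
by case: (leqP m (lev s)) => h2; [move: h; rewrite /shift_index; lia | rewrite oppr0].
Qed.

Lemma step_perturbation_form : perturbation_form step_perturbation.
Proof.
(* A step contributes to one pair at most: its shifted kept coordinate and the variable of the index
   [mi s + 1] it reaches, which [zetavar] stores as [mi s]. *)
exists (fun m (z : zvar e) (d : zetavar e) =>
  \sum_(s | Q s) if ((tag z == kv s) && (tagged z == shift_index s m :> nat))
                 && ((tag d == mv s) && (tagged d == mi s :> nat))
             then c s * shift_sign s m else 0) => m hm.
rewrite /step_perturbation; congr (_ + _).
under [RHS]eq_bigr => z _ do under eq_bigr => d _ do rewrite !scaler_suml.
under [RHS]eq_bigr => z _ do rewrite exchange_big.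
rewrite exchange_big /=; apply: eq_bigr => s hs.
transitivity (\sum_(z : zvar e | (tag z == kv s) && (tagged z == shift_index s m :> nat))
  \sum_(d : zetavar e | (tag d == mv s) && (tagged d == mi s :> nat))
   ((c s * shift_sign s m) *: zeta K e b (tag d) (tagged d).+1)
                  *: zcoord (defring K e b) e (tag z) (tagged z)).
  case: (shift_index_le hs hm) => [h|->]; last first.
    by rewrite mulr0 !scale0r !big1 // => z _; rewrite big1 // => d _; rewrite !scale0r.
  (* If the step reaches the end of its curve, the deformation variable is zero and no [d] carries
     that index. *)
  have [h'|h'] := ltnP (mi s) (e (mv s)).-1; last first.
    rewrite zeta_out ?scaler0 ?scale0r; last by lia.
    rewrite big1 // => z _; rewrite big_pred0 // => -[i j] /=.
    by apply/negP => /andP[/eqP hi /eqP hj]; subst i; have := ltn_ord j; lia.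
  pose F i j := \sum_(d : zetavar e | (tag d == mv s) && (tagged d == mi s :> nat))
   ((c s * shift_sign s m) *: zeta K e b (tag d) (tagged d).+1)
                  *: zcoord (defring K e b) e i j.
  rewrite (big_tagged_pred1 (f := fun i => (e i).+1) F h) /F.
  by rewrite (big_tagged_pred1 (f := fun i => (e i).-1) (fun i j =>
   ((c s * shift_sign s m) *: zeta K e b i j.+1)
      *: zcoord (defring K e b) e (kv s) (shift_index s m)) h').
rewrite [LHS]big_mkcond; apply: eq_bigr => z _.
case: ifP => hz /=; last by rewrite big1 // => d _; rewrite !scale0r.
rewrite [LHS]big_mkcond; apply: eq_bigr => d _.
by case: ifP => hd //; rewrite !scale0r.
Qed.

(** * The lifting identity at a point *)

Section Point.
Variables (A : comAlgType K) (v : defvar e b -> A).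

Definition step_coef (s : S) : A :=
  c s *: at_point v (zeta K e b (mv s) (mi s).+1).

Lemma sum_step_pl_zeta m :
  \sum_(a : zcol e) at_point v (zeta K e b (tag a) (tagged a).+1)
      *: on_scroll (map_mpoly (in_alg A) (step_pl a m))
  = \sum_(s | Q s && (lev s == m)) step_coef s *: on_scroll (zcoord A e (kv s) (ki s)).
Proof.
rewrite -(sum_steps (fun s i j => (c s *: at_point v (zeta K e b i j.+1))
   *: on_scroll (zcoord A e (kv s) (ki s)))); apply: eq_bigr => a _.
rewrite (rmorph_sum (map_mpoly (in_alg A))) (rmorph_sum (@on_scroll A n e)) scaler_sumr.
apply: eq_bigr => s _; rewrite /= map_in_algZ on_scrollZ scalerA.
by rewrite mulrC mulr_algl (map_zcoord (in_alg A)).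
Qed.

(** Coefficients move along the diagonals of constant [j - m], and each step adds [step_coef s] at
    its kept coordinate. *)
Lemma lifting_chart (X : nat -> zring A e) w m j :
    (forall m, (m <= b)%N -> X m \is 1.-homog) ->
    lifting_identity step_pl v X -> (m < b)%N ->
  (chart w (on_scroll (X m.+1)))`_j
  = (if j is j'.+1 then (chart w (on_scroll (X m)))`_j' else 0)
    + \sum_(s | Q s && [&& lev s == m, kv s == w & ki s == j]) step_coef s.
Proof.
move=> hX hid hm; have := hid m hm; rewrite sum_step_pl_zeta => /(chart_rolling w) ->.
rewrite [X in _ + X]rmorph_sum.
rewrite coefD coefXM; congr (_ + _); first by case: j.
rewrite coef_sum [RHS]big_mkcond [LHS]big_mkcond; apply: eq_bigr => s _.
case hs: (Q s) => //=; case: eqP => //= _.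
rewrite chartZ chart_zcoord ?ki_le // !coefZ coefXn [j == _]eq_sym.
by case: (kv s == w); case: (ki s == j); rewrite ?mul0r ?mulr0 ?mul1r ?mulr1.
Qed.

(** For [j < m] the diagonal through [(m, j)] enters at index 0, where there is no previous
    coefficient, so the steps alone determine the value. *)
Lemma lifting_chart_coef (X : nat -> zring A e) w m j :
    (forall m, (m <= b)%N -> X m \is 1.-homog) ->
    lifting_identity step_pl v X -> (m <= b)%N -> (j < m)%N ->
  (chart w (on_scroll (X m)))`_j
  = \sum_(s | Q s && [&& (lev s < m)%N, kv s == w & ki s + m == j + (lev s).+1]%N)
      step_coef s.
Proof.
move=> hX hid; elim: m j => [//|m IH] j hm hj.
rewrite (lifting_chart w j hX hid hm).
case: j hj => [|j] hj.
  rewrite add0r; apply: eq_bigl => s; case: (Q s) => //=.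
  by case: (kv s == w); rewrite ?andbF //=; lia.
rewrite (IH j (ltnW hm) hj) [RHS](bigID (fun s => lev s == m)) /= addrC.
by congr (_ + _); apply: eq_bigl => s; case: (Q s) => //=;
  case: (kv s == w); rewrite ?andbF //=; lia.
Qed.

(** The coefficient of [X m] at [e w] moves to [(e w).+1] in [X m.+1]. No step adds to it there, and
    the degree bound makes it zero. *)
Lemma lifting_equation w m :
    lifting_conditions step_pl v -> (e w < m)%N -> (m < b)%N ->
  \sum_(s | Q s && [&& (lev s < m)%N, kv s == w & ki s + m == e w + (lev s).+1]%N)
      step_coef s = 0.
Proof.
move=> [X [hX hid]] he hm.
rewrite -(lifting_chart_coef w hX hid (ltnW hm) he).
have hQ : (fun s => Q s && [&& lev s == m, kv s == w & ki s == (e w).+1]) =1 pred0.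
  move=> s; case hs: (Q s) => //=; apply/and3P => -[_ /eqP hw /eqP hk].
  by have := ki_le hs; rewrite hw hk ltnn.
have := lifting_chart w (e w).+1 hX hid hm.
rewrite (big_pred0 _ _ _ _ hQ) addr0 => <-.
exact: chart_coef_big (hX _ hm) (ltnSn (e w)).
Qed.

(** [U] and [U'] stand for the kept curve's coordinates times $s$ and $t$. Consecutive terms cancel
    except at [m = lev s], the required source, and where a forward shift is at the end of its curve
    and is cut off at [m.+1]. *)
Lemma shift_identity (V : lmodType A) (U U' : nat -> V) (d : A) s m : Q s ->
    (forall j, (j < e (kv s))%N -> U j.+1 = U' j) ->
  (shift_sign s m.+1 *: d) *: U (shift_index s m.+1)
  - (shift_sign s m *: d) *: U' (shift_index s m)
  = (if lev s == m then d *: U (ki s) else 0)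
    - (if [&& ki s <= lev s, lev s < m & ki s + m == e (kv s) + (lev s).+1]%N
       then d *: U' (e (kv s)) else 0).
Proof.
move=> hs hU; have hk := ki_le hs; rewrite /shift_sign.
set E := e (kv s) in hk hU *.
have [hl|hl] := leqP (ki s) (lev s) => /=; last first.
  rewrite subr0; case: (ltngtP (lev s) m) => hm /=.
  - by rewrite oppr0 !scale0r subr0.
  - rewrite /shift_index (_ : ki s + m.+1 - (lev s).+1 = (ki s + m - (lev s).+1).+1)%N; last by lia.
    by rewrite hU ?subrr //; lia.
  rewrite oppr0 !scale0r sub0r scaleN1r scaleNr opprK /shift_index -hU; last by lia.
  by congr (_ *: U _); lia.
case: (ltngtP (lev s) m) => hm /=.
- rewrite (leqW hm) /= sub0r.
  have -> : shift_index s m.+1 = (shift_index s m).+1 by rewrite /shift_index; lia.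
  (* Before the end the two terms cancel, beyond it both are cut off, and at the end only the
     $t$-term remains. *)
  case: (ltngtP (shift_index s m) E) => hi.
  + by rewrite !scale1r hU // subrr ifN ?oppr0 //; move: hi; rewrite /shift_index; lia.
  + by rewrite !scale0r subr0 ifN ?oppr0 //; move: hi; rewrite /shift_index; lia.
  rewrite !scale0r sub0r scale1r hi ifT //; move: hi; rewrite /shift_index; lia.
- by rewrite ltnNge hm /= !scale0r !subr0.
have -> : shift_index s m.+1 = ki s by rewrite /shift_index; lia.
by rewrite -hm ltnS leqnn hk /= scale1r !scale0r.
Qed.

(** The cut-off terms on a curve [w] are all multiples of [y * M w (e w)], and their coefficients
    add up to a lifting equation. *)
Lemma shift_sum (B : algType A) (x y : B) (M : 'I_n -> nat -> B) (d : S -> A) m :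
    (forall i j, (j < e i)%N -> x * M i j.+1 = y * M i j) ->
    (forall w, (e w < m)%N -> \sum_(s | Q s &&
      [&& (lev s < m)%N, kv s == w & ki s + m == e w + (lev s).+1]%N) d s = 0) ->
  x * (\sum_(s | Q s) (shift_sign s m.+1 *: d s) *: M (kv s) (shift_index s m.+1))
  - y * (\sum_(s | Q s) (shift_sign s m *: d s) *: M (kv s) (shift_index s m))
  - x * (\sum_(s | Q s && (lev s == m)) d s *: M (kv s) (ki s)) = 0.
Proof.
move=> hM hd; rewrite !mulr_sumr -sumrB.
under eq_bigr => s hs.
  rewrite -!scalerAr (shift_identity (U := fun j => x * M (kv s) j)
    (U' := fun j => y * M (kv s) j) _ _ hs); last exact: hM.
  over.
rewrite sumrB -big_mkcondr.
under [X in _ - X]eq_bigr do rewrite -scalerAr.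
rewrite addrAC subrr sub0r; apply/eqP; rewrite oppr_eq0; apply/eqP.
rewrite (partition_big kv xpredT) //= big1 // => w _.
(* Under the index condition, [ki s <= lev s] amounts to [e w < m], the range of the lifting
   equations. *)
transitivity ((\sum_(s | Q s && [&& (lev s < m)%N, kv s == w & ki s + m == e w + (lev s).+1]%N
    && (e w < m)%N) d s) *: (y * M w (e w))).
  rewrite scaler_suml -big_mkcondr big_mkcond [RHS]big_mkcond; apply: eq_bigr => s _.
  case: (Q s); rewrite //= ?if_same //.
  case: (eqVneq (kv s) w) => [->|]; rewrite ?andbF //=.
  by congr (if _ then _ else _); lia.
have [he|he] := boolP (e w < m)%N; last first.
  by rewrite big_pred0 ?scale0r // => s; rewrite !andbF.
rewrite (eq_bigl (fun s => Q s && [&& (lev s < m)%N, kv s == w & ki s + m == e w + (lev s).+1]%N)).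
  by rewrite hd // scale0r.
by move=> s; rewrite andbT.
Qed.

Lemma map_step_perturbation m :
  on_scroll (map_mpoly (at_point v) (step_perturbation m))
  = \sum_(s | Q s) (shift_sign s m *: step_coef s)
                  *: on_scroll (zcoord A e (kv s) (shift_index s m))
    + \sum_(i < n) \sum_(a < (e i).+1 - b)
        at_point v (rho K e b i a) *: on_scroll (zcoord A e i (m + a)).
Proof.
rewrite rmorphD /= (rmorph_sum (map_mpoly (at_point v))).
rewrite rmorphD /= (rmorph_sum (@on_scroll A n e)); congr (_ + _).
  apply: eq_bigr => s _ /=.
  by rewrite (map_mpolyZ (at_point v)) on_scrollZ /= at_pointZ mulrC -scalerA
    (map_zcoord (at_point v)).
rewrite (rmorph_sum (map_mpoly (at_point v))) (rmorph_sum (@on_scroll A n e)).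
apply: eq_bigr => i _ /=.
rewrite (rmorph_sum (map_mpoly (at_point v))) (rmorph_sum (@on_scroll A n e)).
apply: eq_bigr => a _ /=.
by rewrite (map_mpolyZ (at_point v)) on_scrollZ (map_zcoord (at_point v)).
Qed.

Lemma step_lifting_identity : lifting_conditions step_pl v ->
  lifting_identity step_pl v (fun m => map_mpoly (at_point v) (step_perturbation m)).
Proof.
move=> hv m hm.
set G := fun m : nat => \sum_(i < n) \sum_(a < (e i).+1 - b)
  at_point v (rho K e b i a) *: on_scroll (zcoord A e i (m + a)).
have hG : cox_s A n * G m.+1 = cox_t A n * G m.
  rewrite !mulr_sumr; apply: eq_bigr => i _; rewrite !mulr_sumr; apply: eq_bigr => a _.
  by rewrite -!scalerAr addSn rolling_zcoord //; have := ltn_ord a; lia.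
apply: (mulrBB_eq0 (map_step_perturbation m.+1) (map_step_perturbation m)
  (sum_step_pl_zeta m) hG).
apply: (shift_sum (B := coxring A n) (M := fun i j => on_scroll (zcoord A e i j))
  (d := step_coef)) => [i j hj|w he]; [exact: rolling_zcoord | exact: lifting_equation].
Qed.
End Point.

Lemma step_lifting_family : lifting_family step_pl step_perturbation.
Proof. by split=> [|A v hv]; [apply: step_perturbation_form | apply: step_lifting_identity]. Qed.
End Scheme.

(** * Combinatorics of the terms in the base equations *)

Lemma big_nat_if (V : nmodType) N u v (F : nat -> V) : (v <= N)%N ->
  \sum_(u <= a < v) F a = \sum_(0 <= a < N) if (u <= a < v)%N then F a else 0.
Proof.
move=> hv; rewrite (big_nat_widenl _ 0) // (big_nat_widen _ _ N) // big_mkcond.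
by apply: eq_bigr => a _; rewrite andTb andbC.
Qed.

Section BaseTerm.
Variables (V : comNzRingType) (ex ey b k m : nat) (xi eta : nat -> V).
Hypothesis xi_out : forall j, ~~ (0 < j < ex)%N -> xi j = 0.
Hypothesis eta_out : forall j, ~~ (0 < j < ey)%N -> eta j = 0.
Hypothesis hle : (ey <= ex)%N.
Hypothesis hk : (k + b <= ex + ey)%N.
Hypothesis hm : (1 <= m <= b - 1)%N.

Let i0 := minn k (ex - b).
Let T a := eta (k + m - a)%N * xi a.

Lemma T_out a : ~~ [&& 0 < a < ex, a < k + m & k + m < ey + a]%N -> T a = 0.
Proof.
move=> h; rewrite /T; have [ha|ha] := boolP (0 < a < ex)%N.
  by rewrite eta_out ?mul0r //; lia.
by rewrite xi_out ?mulr0.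
Qed.

(** With [a] the index reached, [T a] occurs with sign plus for [k < a <= i0 + m] and minus for
    [i0 + m < a <= k]. The subtracted term supplies the lower end of the negative sum or removes the
    upper end of the positive one. *)
Lemma base_term_path :
  \sum_(l < b) (if (i0 + l < ex)%N then
       if (k <= i0 + l)%N then if (l < m)%N then T (i0 + l).+1 else 0
       else if (m <= l)%N then - T (i0 + l).+1 else 0
     else 0) - T (minn (i0 + m) ex)
  = base_term ex ey b k m xi eta.
Proof.
set W := fun a => if (a <= ex)%N then
       if (k < a)%N then if (a <= i0 + m)%N then T a else 0
       else if (i0 + m < a)%N then - T a else 0
     else 0.
(* [N] exceeds every upper bound that occurs, so all sums can be compared term by term over one
   range. *)
pose N := (ex + b + k + m).+2.
have -> : T (minn (i0 + m) ex) = \sum_(0 <= a < N) if a == minn (i0 + m) ex then T a else 0.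
  by rewrite -big_mkcond big_nat1_eq ifT //; rewrite /i0; lia.
transitivity (\sum_(0 <= a < N) ((if (i0.+1 <= a < i0.+1 + b)%N then W a else 0)
  - if a == minn (i0 + m) ex then T a else 0)).
  rewrite sumrB -big_nat_if; last by rewrite /i0; lia.
  have -> : \sum_(i0.+1 <= a < i0.+1 + b) W a = \sum_(0 <= l < b) W (l + i0.+1)%N.
    by rewrite -{1}[i0.+1]add0n big_addn addKn.
  congr (_ - _); rewrite [RHS]big_mkord.
  by apply: eq_bigr => l _; rewrite /W addnS [(l + _)%N]addnC !ltnS leq_add2l ltn_add2l.
set L := \sum_(0 <= a < N) _.
(* Only those [a] matter for which [T a] can be nonzero; this absorbs the bounds involving [ex] and
   [ey]. *)
have eqL (F : nat -> V) : (forall a, [&& 0 < a < ex, a < k + m & k + m < ey + a]%N ->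
    (if (i0.+1 <= a < i0.+1 + b)%N then W a else 0)
     - (if a == minn (i0 + m) ex then T a else 0) = F a) ->
   (forall a, T a = 0 -> F a = 0) -> L = \sum_(0 <= a < N) F a.
  move=> h1 h2; apply: eq_bigr => a _.
  have [/h1 //|/T_out h] := boolP [&& 0 < a < ex, a < k + m & k + m < ey + a]%N.
  by rewrite h2 // /W h oppr0 !if_same subr0.
have hi0 : (if (ex < b)%N then i0 = 0%N
            else if (m + ex <= k + b)%N then i0 = (ex - b)%N else i0 = minn k (ex - b)).
  by rewrite /i0; case: ifP => ?; [|case: ifP => ?]; lia.
rewrite /base_term; case: ifP hi0 => hb hi0; case: ifP hi0 => hc hi0;
  rewrite (@big_nat_if _ N) -?sumrN; try (by rewrite /N; lia);
  apply: eqL => a h; rewrite -/(T a); try (by rewrite h ?oppr0 if_same ?oppr0);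
  rewrite /W; clear L W N; rewrite hi0; clear i0 hi0;
  rewrite (_ : (a <= ex)%N = true); try (by lia);
  do ![case: ifP => ? //]; rewrite ?subr0 ?sub0r ?oppr0 ?subrr //.
all: lia.
Qed.
End BaseTerm.

(** * The path of a monomial *)

Section Path.
Variables (K : comNzRingType) (n b : nat) (e : 'I_n -> nat).
Variables (T : finType) (P : pred T) (p : T -> K) (x y : T -> 'I_n) (k : T -> nat).
Hypothesis le_yx : forall t, P t -> (e (y t) <= e (x t))%N.
Hypothesis k_le : forall t, P t -> (k t + b <= e (x t) + e (y t))%N.

(** Truncation starts the path at 0 if [e (x t) < b]; otherwise the start leaves room for all [b]
    steps to raise $x$. *)
Definition path_x (t : T) (m : nat) : nat := minn (minn (k t) (e (x t) - b) + m) (e (x t)).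
Definition path_y (t : T) (m : nat) : nat := (k t + m - path_x t m)%N.

Definition path_form (m : nat) : zring K e :=
  \sum_(t | P t) p t *: (zcoord K e (x t) (path_x t m) * zcoord K e (y t) (path_y t m)).

(** The bound [k_le] keeps the index of $y$ on its curve; the last inequality makes the subtraction
    in [path_y] exact. *)
Lemma path_le t m : P t -> (m <= b)%N ->
  [&& path_x t m <= e (x t), path_y t m <= e (y t) & path_x t m <= k t + m]%N.
Proof. by move=> ht hm; have := le_yx ht; have := k_le ht; rewrite /path_y /path_x; lia. Qed.

Lemma path_step t l : P t -> (l < b)%N ->
  if (path_x t l < e (x t))%N
  then path_x t l.+1 = (path_x t l).+1 /\ path_y t l.+1 = path_y t l
  else [/\ path_x t l.+1 = path_x t l, path_y t l.+1 = (path_y t l).+1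
        & (path_y t l < e (y t))%N].
Proof.
move=> ht hl; have := le_yx ht; have := k_le ht.
by case: ifP => h hk he; split; move: h; rewrite /path_y /path_x; lia.
Qed.

Let S : finType := (T * 'I_b)%type.
Let Q (s : S) := P s.1.
Let lev (s : S) : nat := s.2.
Definition moves_x (s : T * 'I_b) : bool := (path_x s.1 s.2 < e (x s.1))%N.
Definition move_var (s : T * 'I_b) := if moves_x s then x s.1 else y s.1.
Definition move_idx (s : T * 'I_b) := if moves_x s then path_x s.1 s.2 else path_y s.1 s.2.
Definition keep_var (s : T * 'I_b) := if moves_x s then y s.1 else x s.1.
Definition keep_idx (s : T * 'I_b) := if moves_x s then path_y s.1 s.2 else path_x s.1 s.2.

Lemma move_idx_lt s : Q s -> (move_idx s < e (move_var s))%N.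
Proof.
move=> hs; have := path_step hs (ltn_ord s.2).
by rewrite /move_idx /move_var /moves_x; case: ifP => // _ [].
Qed.

Lemma keep_idx_le s : Q s -> (keep_idx s <= e (keep_var s))%N.
Proof.
move=> hs; have := path_le hs (ltnW (ltn_ord s.2)).
by rewrite /keep_idx /keep_var; case: ifP => _ /and3P[].
Qed.

Lemma path_form_step (s : S) :
  zcoord K e (keep_var s) (keep_idx s) * zcoord K e (move_var s) (move_idx s)
  = zcoord K e (x s.1) (path_x s.1 s.2) * zcoord K e (y s.1) (path_y s.1 s.2).
Proof. by rewrite /keep_var /keep_idx /move_var /move_idx; case: ifP; rewrite // mulrC. Qed.

Lemma path_form_stepS (s : S) : Q s ->
  zcoord K e (keep_var s) (keep_idx s) * zcoord K e (move_var s) (move_idx s).+1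
  = zcoord K e (x s.1) (path_x s.1 s.2.+1) * zcoord K e (y s.1) (path_y s.1 s.2.+1).
Proof.
move=> hs; have := path_step hs (ltn_ord s.2).
rewrite /keep_var /keep_idx /move_var /move_idx /moves_x.
by case: ifP => _ [-> ->]; rewrite // mulrC.
Qed.

Lemma sum_level (V : nmodType) (F : S -> V) m (hm : (m < b)%N) :
  \sum_(s : S | Q s && (lev s == m)) F s = \sum_(t | P t) F (t, Ordinal hm).
Proof.
rewrite (eq_bigr (fun s => F (s.1, s.2))); last by case.
rewrite -(pair_big_dep P (fun (_ : T) (l : 'I_b) => l == m :> nat) (fun t l => F (t, l))).
by apply: eq_bigr => t _; rewrite (big_pred1 (Ordinal hm)).
Qed.

Definition path_pl : zcol e -> nat -> zring K e :=
  @step_pl K n e S Q (fun s => p s.1) lev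
    move_idx keep_idx move_var keep_var.
Definition path_perturbation : nat -> zring (defring K e b) e :=
  @step_perturbation K n b e S Q (fun s => p s.1) lev
    move_idx keep_idx move_var keep_var.

Lemma path_rolling m : (m < b)%N ->
  path_form m = \sum_(a : zcol e) path_pl a m * zcoord K e (tag a) (tagged a)
  /\ path_form m.+1 = \sum_(a : zcol e) path_pl a m * zcoord K e (tag a) (tagged a).+1.
Proof.
move=> hm; split.
  under eq_bigr => a _ do rewrite mulr_suml.
  rewrite (sum_steps lev move_idx_lt (fun s i j => (p s.1 *:
    zcoord K e (keep_var s) (keep_idx s)) * zcoord K e i j)) (sum_level _ hm).
  by apply: eq_bigr => t ht; rewrite -scalerAl path_form_step.
under eq_bigr => a _ do rewrite mulr_suml.
rewrite (sum_steps lev move_idx_lt (fun s i j => (p s.1 *: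
  zcoord K e (keep_var s) (keep_idx s)) * zcoord K e i j.+1)) (sum_level _ hm).
by apply: eq_bigr => t ht; rewrite -scalerAl path_form_stepS.
Qed.

Lemma path_form_homog m : path_form m \is 2.-homog.
Proof.
apply: rpred_sum => t _; apply: dhomogZ.
by apply: (@dhomogM _ _ _ 1 _ 1); apply: zcoord_homog.
Qed.

Lemma on_scroll_path_form m : (m <= b)%N ->
  on_scroll (path_form m) = cox_s K n ^+ (b - m) * cox_t K n ^+ m *
    \sum_(t | P t) p t *: (cox_s K n ^+ (e (x t) + e (y t) - b - k t) * cox_t K n ^+ k t
                          * (cox_z K (x t) * cox_z K (y t))).
Proof.
move=> hm; rewrite (rmorph_sum (@on_scroll K n e)) mulr_sumr; apply: eq_bigr => t ht.
have /and3P[h1 h2 h3] := path_le ht hm; have hk := k_le ht.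
rewrite /= on_scrollZ (rmorphM (@on_scroll K n e)) /= !on_scroll_zcoord //.
rewrite -scalerAr; congr (_ *: _).
have -> : cox_s K n ^+ (b - m) * cox_t K n ^+ m * (cox_s K n ^+ (e (x t) + e (y t) - b - k t) *
   cox_t K n ^+ k t * (cox_z K (x t) * cox_z K (y t)))
  = cox_z K (x t) * cox_z K (y t) * (cox_s K n ^+ (b - m) * cox_s K n ^+ (e (x t) + e (y t) - b - k t))
   * (cox_t K n ^+ m * cox_t K n ^+ k t) by ring.
rewrite -!exprD.
have -> : (b - m + (e (x t) + e (y t) - b - k t) = (e (x t) - path_x t m) + (e (y t) - path_y t m))%N.
  by move: h2; rewrite /path_y; lia.
have -> : (m + k t = path_x t m + path_y t m)%N by rewrite /path_y; lia.
by rewrite !exprD; ring.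
Qed.

Local Notation z_ i := (zeta K e b i).

(** A step raising $y$ gives zero: it keeps $x$ at its end, so its shifted index is [e (x t)], where
    [zeta] vanishes, or lies beyond and is cut off. *)
Lemma path_step_value t (l : 'I_b) m : P t -> (m <= b)%N ->
  shift_sign K e lev keep_idx keep_var (t, l) m
    *: (z_ (move_var (t, l)) (move_idx (t, l)).+1
        * z_ (keep_var (t, l)) (shift_index lev keep_idx (t, l) m))
  = let a := (minn (k t) (e (x t) - b) + l).+1 in
    if (minn (k t) (e (x t) - b) + l < e (x t))%N then
      if (k t <= minn (k t) (e (x t) - b) + l)%N
      then if (l < m)%N then z_ (y t) (k t + m - a) * z_ (x t) a else 0
      else if (m <= l)%N then - (z_ (y t) (k t + m - a) * z_ (x t) a) else 0
    else 0.
Proof.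
move=> ht hm; have hl := ltn_ord l.
rewrite /move_var /move_idx /keep_var /keep_idx /shift_sign /shift_index /moves_x /lev /=.
have -> : (path_x t l < e (x t) = (minn (k t) (e (x t) - b) + l < e (x t)))%N.
  by rewrite /path_x; lia.
case: (boolP (minn (k t) (e (x t) - b) + l < e (x t))%N) => hx /=.
  have hpx : path_x t l = (minn (k t) (e (x t) - b) + l)%N by rewrite /path_x; lia.
  have -> : path_y t l = (k t - minn (k t) (e (x t) - b))%N by rewrite /path_y hpx subnDr.
  rewrite hpx; set i0 := minn _ _; have hi0 : (i0 <= k t)%N by rewrite /i0; lia.
  have -> : (k t - i0 <= l = (k t <= i0 + l))%N by lia.
  have -> : (k t - i0 + m - l.+1 = k t + m - (i0 + l).+1)%N by lia.
  rewrite [X in _ *: X]mulrC; case: ifP => hk.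
    case: (ltnP l m) => hlm /=; last by rewrite scale0r.
    case: leqP => hy; first by rewrite scale1r.
    (* The cut-off agrees with the right side, since [zeta] vanishes past [e (y t)]. *)
    by rewrite scale0r [z_ (y t) _]zeta_out ?mul0r //; lia.
  by case: leqP => hlm; rewrite ?scaleN1r // oppr0 scale0r.
have -> : path_x t l = e (x t) by rewrite /path_x; lia.
(* Raising $y$ requires [e (x t) < b] and [e (x t) <= l], so the shift goes forward. *)
case: ifP => hk; last by have := le_yx ht; have := k_le ht; lia.
case: (ltnP l m) => hlm /=; last by rewrite scale0r.
case: leqP => hy; last by rewrite scale0r.
by rewrite [z_ (x t) _]zeta_out ?mulr0 ?scaler0 //; lia.
Qed.

Lemma eval_step_perturbation m : (m <= b)%N ->
  (path_perturbation m).@[@zeta_point K n e b]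
  = \sum_(s : S | Q s) (p s.1 * shift_sign K e lev keep_idx keep_var s m)
       *: (z_ (move_var s) (move_idx s).+1 * z_ (keep_var s) (shift_index lev keep_idx s m))
    + \sum_(i < n | (b <= e i)%N) \sum_(a < (e i - b).+1) rho K e b i a * z_ i (m + a).
Proof.
move=> hm; rewrite /path_perturbation /step_perturbation (mevalD (@zeta_point K n e b)); congr (_ + _).
  rewrite (rmorph_sum (meval (@zeta_point K n e b))); apply: eq_bigr => s hs /=.
  rewrite mevalZ -scalerAl.
  by case: (shift_index_le K lev keep_idx_le hs hm) => [h|->];
    [rewrite meval_zcoord | rewrite mulr0 !scale0r].
rewrite (rmorph_sum (meval (@zeta_point K n e b))) [RHS]big_mkcond; apply: eq_bigr => i _ /=.
rewrite (rmorph_sum (meval (@zeta_point K n e b))).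
case: ifP => hb; last by rewrite big1 // => a _; have := ltn_ord a; lia.
rewrite (subSn hb); apply: eq_bigr => a _ /=.
by rewrite mevalZ meval_zcoord //; have := ltn_ord a; lia.
Qed.

Lemma path_base_equation m : (1 <= m <= b - 1)%N ->
  base_equation path_form path_perturbation m
  = \sum_(t | P t) p t *: base_term (e (x t)) (e (y t)) b (k t) m (z_ (x t)) (z_ (y t))
    + \sum_(i < n | (b <= e i)%N) \sum_(a < (e i - b).+1) rho K e b i a * z_ i (m + a).
Proof.
move=> hm; have hmb : (m <= b)%N by lia.
rewrite /base_equation eval_step_perturbation // addrAC; congr (_ + _).
rewrite /path_form (rmorph_sum (mmap (@mpolyC _ K) (@zeta_point K n e b))) /=.
rewrite (eq_bigr (fun s => (p s.1 * shift_sign K e lev keep_idx keep_var (s.1, s.2) m)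
       *: (z_ (move_var (s.1, s.2)) (move_idx (s.1, s.2)).+1
           * z_ (keep_var (s.1, s.2)) (shift_index lev keep_idx (s.1, s.2) m)))); last by case.
rewrite (eq_bigl (fun s => P s.1 && true)); last by move=> s; rewrite andbT.
rewrite -(pair_big P xpredT (fun t l => (p t * shift_sign K e lev keep_idx keep_var (t, l) m)
       *: (z_ (move_var (t, l)) (move_idx (t, l)).+1
           * z_ (keep_var (t, l)) (shift_index lev keep_idx (t, l) m)))) -sumrB.
apply: eq_bigr => t ht.
rewrite mmapZ rmorphM /= mul_mpolyC.
have /and3P[h1 h2 _] := path_le ht hmb; rewrite !mmap_zcoord //.
under eq_bigr => l _ do rewrite -scalerA path_step_value //.
rewrite -scaler_sumr -scalerBr; congr (_ *: _).
rewrite -(base_term_path _ _ (le_yx ht) (k_le ht) hm); try by move=> j; apply: zeta_out.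
by rewrite [X in _ - X]mulrC.
Qed.

Lemma path_lifting_family : lifting_family path_pl path_perturbation.
Proof. exact: step_lifting_family move_idx_lt keep_idx_le. Qed.

Lemma path_pl_homog a m : path_pl a m \is 1.-homog.
Proof. exact: step_pl_homog. Qed.
End Path.

(** * Assembling all coefficients of the divisor *)

Lemma prod_expr_mnm2 (B : comNzRingType) n (F : 'I_n -> B) (i j : 'I_n) :
  \prod_(l < n) F l ^+ (U_(i) + U_(j))%MM l = F i * F j.
Proof.
have prod1 (h : 'I_n) : \prod_(l < n) F l ^+ U_(h)%MM l = F h.
  rewrite (bigD1 h) //= mnm1E eqxx big1 ?mulr1 // => l hl.
  by rewrite mnm1E eq_sym (negbTE hl).
by under eq_bigr => l _ do rewrite mnmDE exprD; rewrite big_split /= !prod1.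
Qed.

Lemma pairing_mnm2 n (e : 'I_n -> nat) (i j : 'I_n) :
  pairing e (U_(i) + U_(j))%MM = (e i + e j)%N.
Proof.
have sum1 (h : 'I_n) : (\sum_(l < n) e l * U_(h)%MM l = e h)%N.
  rewrite (bigD1 h) //= mnm1E eqxx muln1 big1 ?addn0 // => l hl.
  by rewrite mnm1E eq_sym (negbTE hl) muln0.
rewrite /pairing; under eq_bigr => l _ do rewrite mnmDE mulnDr.
by rewrite big_split /= !sum1.
Qed.

Lemma rolling_base_equations (K : comNzRingType) (n b : nat) (e : 'I_n -> nat)
    (p : 'X_{1..n} -> nat -> K) (x y : 'X_{1..n} -> 'I_n)
    (hxy : forall I : 'X_{1..n}, mdeg I = 2%N ->
       I = (U_(x I) + U_(y I))%MM /\ (e (y I) <= e (x I))%N) :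
  exists (Pm : nat -> zring K e) (pl : zcol e -> nat -> zring K e)
         (P' : nat -> zring (defring K e b) e),
    [/\ rolling_factors b (divisor_poly e b p) Pm pl,
        lifting_family pl P'
      & forall m : nat, (1 <= m <= b - 1)%N ->
          base_equation Pm P' m
          = \sum_(I : 'X_{1..n < 3} | mdeg I == 2%N) \sum_(k < ncoef e b I)
              p I k *: base_term (e (x I)) (e (y I)) b k m
                         (zeta K e b (x I)) (zeta K e b (y I))
            + \sum_(i < n | (b <= e i)%N) \sum_(a < (e i - b).+1)
                rho K e b i a * zeta K e b i (m + a)].
Proof.
pose T : finType := {I : 'X_{1..n < 3} & 'I_(ncoef e b I)}.
pose P (t : T) := mdeg (tag t) == 2%N.
pose p' (t : T) := p (tag t) (tagged t).
pose x' (t : T) := x (tag t); pose y' (t : T) := y (tag t).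
pose k' (t : T) : nat := tagged t.
have hT (t : T) : P t -> pairing e (tag t) = (e (x' t) + e (y' t))%N.
  by move=> /eqP ht; have [hI _] := hxy _ ht; rewrite (congr1 (pairing e) hI) pairing_mnm2.
have le_yx (t : T) : P t -> (e (y' t) <= e (x' t))%N by move=> /eqP /hxy [].
have k_le (t : T) : P t -> (k' t + b <= e (x' t) + e (y' t))%N.
  (* If $\langle e,I\rangle < b$, the truncated bound is zero and no such [k' t] exists. *)
  move=> /hT <-; have : (k' t < (pairing e (tag t)).+1 - b)%N := ltn_ord (tagged t).
  by move: (k' t) (pairing _ _); lia.
exists (@path_form K n b e T P p' x' y' k'), (@path_pl K n b e T P p' x' y' k'),
  (@path_perturbation K n b e T P p' x' y' k'); split.
- split.
  + by move=> m _; apply: path_form_homog.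
  + move=> m hm; rewrite (on_scroll_path_form p' le_yx k_le hm); congr (_ * _).
    rewrite /divisor_poly sig_big_dep; apply: eq_big => [t|t ht]; first by rewrite andbT.
    have /eqP /hxy [hI _] := ht.
    have := prod_expr_mnm2 (cox_z K (n := n)) (x' t) (y' t); rewrite -hI => <-.
    by rewrite -hT.
  + by move=> a m _; apply: path_pl_homog.
  + by move=> m; apply: path_rolling.
- exact: path_lifting_family.
- move=> m hm; rewrite (path_base_equation p' le_yx k_le hm); congr (_ + _).
  by rewrite [RHS]sig_big_dep; apply: eq_bigl => t; rewrite andbT.
Qed.

Theorem theorem3p4 (R : realType) (n b : nat) (e : 'I_n -> nat)
    (p : 'X_{1..n} -> nat -> R[i])
    (hP : divisor_poly e b p != 0)
    (x y : 'X_{1..n} -> 'I_n)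
    (hxy : forall I : 'X_{1..n}, mdeg I = 2%N ->
       I = (U_(x I) + U_(y I))%MM /\ (e (y I) <= e (x I))%N) :
  exists (Pm : nat -> zring R[i] e) (pl : zcol e -> nat -> zring R[i] e)
         (P' : nat -> zring (defring R[i] e b) e),
    [/\ rolling_factors b (divisor_poly e b p) Pm pl,
        lifting_family pl P'
      & forall m : nat, (1 <= m <= b - 1)%N ->
          base_equation Pm P' m
          = \sum_(I : 'X_{1..n < 3} | mdeg I == 2%N) \sum_(k < ncoef e b I)
              p I k *: base_term (e (x I)) (e (y I)) b k m
                         (zeta R[i] e b (x I)) (zeta R[i] e b (y I))
            + \sum_(i < n | (b <= e i)%N) \sum_(a < (e i - b).+1)
                rho R[i] e b i a * zeta R[i] e b i (m + a)].
Proof. exact: rolling_base_equations. Qed.
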